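(* Let $n,N\ge 1$, let $q_1,\dots,q_N\in\mathbb{R}^{n\times n}$ be symmetric positive definite, let $g_2,\dots,g_N\in\mathbb{R}^{n\times n}$ be arbitrary, let $q=\mathrm{diag}\{q_1,\dots,q_N\}$ be the block diagonal matrix with diagonal blocks $q_k$, let $g\in\mathbb{R}^{nN\times nN}$ be the block lower bidiagonal matrix with identity diagonal blocks and with $g_k$ in block position $(k,k-1)$ for $k=2,\dots,N$ (all other blocks zero), and let $E=g^{\mathrm T}q^{-1}g$. Then $$\frac{\sigma_{\min}^2(g)}{\lambda_{\max}(q)}\le \lambda_{\min}(E)\le\lambda_{\max}(E)\le\frac{\sigma_{\max}^2(g)}{\lambda_{\min}(q)}.$$
   Context: $\lambda_{\min},\lambda_{\max}$ denote the minimum and maximum eigenvalues of a symmetric matrix, and $\sigma_{\min},\sigma_{\max}$ the minimum and maximum singular values of a matrix. *)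

(* Defs.v *)
From mathcomp Require Import all_boot all_order all_algebra.
From mathcomp Require Import boolp classical_sets reals.

Set Implicit Arguments.
Unset Strict Implicit.
Unset Printing Implicit Defensive.

Import Order.TTheory GRing.Theory Num.Theory.
Local Open Scope classical_set_scope.
Local Open Scope ring_scope.

(* Default value 0 when [S] has no minimum (resp. maximum); see [set_minE],
   [set_maxE]. *)
Definition set_min (R : realType) (S : set R) : R :=
  xget 0 [set m | S m /\ lbound S m].
Definition set_max (R : realType) (S : set R) : R :=
  xget 0 [set m | S m /\ ubound S m].

Lemma set_minE (R : realType) (S : set R) (m : R) :
  S m -> lbound S m -> set_min S = m.
Proof.
move=> Sm lbm; rewrite /set_min.
case: xgetP => [y _ [Sy lby]|/(_ m) []//].
by apply/eqP; rewrite eq_le lby //= lbm.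
Qed.

Lemma set_maxE (R : realType) (S : set R) (m : R) :
  S m -> ubound S m -> set_max S = m.
Proof.
move=> Sm ubm; rewrite /set_max.
case: xgetP => [y _ [Sy uby]|/(_ m) []//].
by apply/eqP; rewrite eq_le uby // ubm.
Qed.

(* [eigenvalue] refers to left (row) eigenvectors, which yield the same set of
   eigenvalues as right ones. *)
Definition spectrum (R : realType) (m : nat) (A : 'M[R]_m) : set R :=
  [set a | eigenvalue A a].

Definition lambda_min (R : realType) (m : nat) (A : 'M[R]_m) : R :=
  set_min (spectrum A).
Definition lambda_max (R : realType) (m : nat) (A : 'M[R]_m) : R :=
  set_max (spectrum A).

Definition singular_values (R : realType) (m : nat) (A : 'M[R]_m) : set R :=
  [set Num.sqrt a | a in spectrum (A^T *m A)].

Definition sigma_min (R : realType) (m : nat) (A : 'M[R]_m) : R :=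
  set_min (singular_values A).
Definition sigma_max (R : realType) (m : nat) (A : 'M[R]_m) : R :=
  set_max (singular_values A).

Definition sym_posdef (R : realType) (m : nat) (A : 'M[R]_m) : Prop :=
  A^T = A /\ forall x : 'cV[R]_m, x != 0 -> 0 < (x^T *m A *m x) 0 0.

(* Blocks are numbered from 0, so that [gs k] sits in block position
   (k, k - 1) for 0 < k < N; the entry [gs 0] is not used. *)
Definition block_bidiag (R : realType) (n N : nat) (gs : 'I_N -> 'M[R]_n) :
    'M[R]_(\sum_(i < N) n) :=
  \mxblock_(i < N, j < N)
    (if i == j then 1%:M else if (i : nat) == j.+1 then gs i else 0).

(* Main.v *)
Require Import Defs.
From mathcomp Require Import all_boot all_order all_algebra.
From mathcomp Require Import classical_sets reals.
From mathcomp Require Import ring lra.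

Import Order.TTheory GRing.Theory Num.Theory.
Local Open Scope ring_scope.

(** Everything is read off Rayleigh quotients.  If [u] is an eigenvector of
    [E = g^T q^-1 g] for the eigenvalue [a] and [w = u g^T], then
    [a |u|^2 = w q^-1 w^T].  The right-hand side lies between
    [|w|^2 / lambda_max q] and [|w|^2 / lambda_min q] ([qform_invmx]), because
    the eigenvalues of [q^-1] are inverses of eigenvalues of [q]; and
    [|w|^2 = u (g^T g) u^T] lies between [sigma_min g ^+ 2 * |u|^2] and
    [sigma_max g ^+ 2 * |u|^2], the extreme eigenvalues of [g^T g] being the
    squares of the extreme singular values ([sqr_sigma_min], [sqr_sigma_max]).
    Taking for [a] the extreme eigenvalues of [E] gives both outer
    inequalities ([lambda_congr_bounds]), once the block diagonal [q] is known
    to be positive definite ([sym_posdef_mxdiag]).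

    The remaining ingredient is that a symmetric real matrix has a smallest
    eigenvalue, which bounds its quadratic form from below ([rayleigh_min]).
    The candidate is the largest [a] with [a |u|^2 <= u A u^T] for all [u],
    a supremum of reals.  Were [B = A - a] invertible, the form of [B], being
    nonnegative, would be bounded below by a positive multiple of [|u|^2]
    ([psd_unit_coercive]) and [a] could be increased. *)

(** * Quadratic forms on row vectors *)

Section QuadraticForms.
Context {R : realType} {m : nat}.
Implicit Types (A B : 'M[R]_m) (u v w : 'rV[R]_m) (a b c : R).

Definition sqnorm u : R := (u *m u^T) 0 0.
Definition qform A u : R := (u *m A *m u^T) 0 0.

Lemma sqnormE u : sqnorm u = \sum_i u 0 i ^+ 2.
Proof. by rewrite /sqnorm mxE; apply: eq_bigr => i _; rewrite mxE expr2. Qed.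

Lemma sqnorm_ge0 u : 0 <= sqnorm u.
Proof. by rewrite sqnormE sumr_ge0 // => i _; rewrite sqr_ge0. Qed.

Lemma sqr_coord_le_sqnorm u i : u 0 i ^+ 2 <= sqnorm u.
Proof.
rewrite sqnormE (bigD1 i) //= lerDl sumr_ge0 // => j _; exact: sqr_ge0.
Qed.

Lemma sqnorm_gt0 u : u != 0 -> 0 < sqnorm u.
Proof.
move=> u0; rewrite lt0r sqnorm_ge0 andbT; apply: contra u0 => /eqP u0.
apply/eqP/rowP => i; apply/eqP; rewrite mxE -sqrf_eq0 eq_le sqr_ge0 andbT -u0.
exact: sqr_coord_le_sqnorm.
Qed.

Lemma qform_scalar a u : qform a%:M u = a * sqnorm u.
Proof. by rewrite /qform mul_mx_scalar -[LHS]/((_ *m _) 0 0) -scalemxAl mxE. Qed.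

Lemma qformB A B u : qform (A - B) u = qform A u - qform B u.
Proof. by rewrite /qform mulmxBr mulmxBl !mxE. Qed.

Lemma qformN A u : qform (- A) u = - qform A u.
Proof. by rewrite /qform mulmxN mulNmx mxE. Qed.

Lemma qform_congr A B u : qform (A *m B *m A^T) u = qform B (u *m A).
Proof. by rewrite /qform trmx_mul !mulmxA. Qed.

Lemma sqnorm_mulmx A u : sqnorm (u *m A) = qform (A *m A^T) u.
Proof. by rewrite /qform /sqnorm trmx_mul !mulmxA. Qed.

Lemma qform_eigenvector A a u : u *m A = a *: u -> qform A u = a * sqnorm u.
Proof. by move=> uA; rewrite /qform uA -scalemxAl mxE. Qed.

(** The sum of the absolute values of the entries dominates the form because
    [|u_i u_j| <= |u|^2]; adding 1 makes the constant positive. *)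
Lemma qform_bound A :
  exists2 c : R, 0 < c & forall u, qform A u <= c * sqnorm u.
Proof.
exists (1 + \sum_i \sum_j `|A j i|).
  by rewrite ltr_pwDl // sumr_ge0 // => i _; rewrite sumr_ge0.
move=> u; rewrite mulrDl mul1r.
apply: (@le_trans _ _ ((\sum_i \sum_j `|A j i|) * sqnorm u)); last first.
  by rewrite lerDr sqnorm_ge0.
rewrite /qform mxE mulr_suml ler_sum // => i _.
rewrite !mxE !mulr_suml ler_sum // => j _.
apply: le_trans (ler_norm _) _.
rewrite (mulrC (u 0 j)) -mulrA normrM ler_wpM2l // normrM.
have := sqr_coord_le_sqnorm u i; have := sqr_coord_le_sqnorm u j.
rewrite -(real_normK (num_real (u 0 i))) -(real_normK (num_real (u 0 j))).
have := sqr_ge0 (`|u 0 j| - `|u 0 i|); nra.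
Qed.

(** Moving from [u] in the direction of the gradient of the form at [u]. *)
Lemma qform_perturb B u t : B^T = B ->
  qform B (u - t *: (u *m B))
  = qform B u - t * sqnorm (u *m B) *+ 2 + t ^+ 2 * qform B (u *m B).
Proof.
move=> Bsym; rewrite /qform /sqnorm; set v := u *m B.
have cross : v *m B *m u^T = v *m v^T.
  by rewrite /v [in RHS]trmx_mul Bsym !mulmxA.
rewrite mulmxBl [(u - _)^T]raddfB /= !mulmxBr !mulmxBl -!scalemxAl [(t *: v)^T]linearZ /=.
rewrite -!scalemxAr cross -/v !mxE; ring.
Qed.

(** A gradient step of length [1 / k], where [k] bounds the form of [B], keeps
    the form nonnegative, which gives [|uB|^2 <= k * uBu^T]; and invertibility
    of [B] bounds [|u|^2] by a multiple of [|uB|^2]. *)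
Lemma psd_unit_coercive B : B^T = B -> B \in unitmx ->
  (forall u, 0 <= qform B u) ->
  exists2 c : R, 0 < c & forall u, c * sqnorm u <= qform B u.
Proof.
move=> Bsym Bunit Bpsd.
have [k k0 kB] := qform_bound B.
have [l l0 lB] := qform_bound (invmx B *m (invmx B)^T).
exists (k * l)^-1; first by rewrite invr_gt0 mulr_gt0.
move=> u; rewrite mulrC ler_pdivrMr ?mulr_gt0 //.
have uE : sqnorm u <= l * sqnorm (u *m B).
  by have := lB (u *m B); rewrite -sqnorm_mulmx mulmxK.
apply: le_trans uE _; rewrite [k * l]mulrC mulrCA ler_pM2l //.
have := Bpsd (u - k^-1 *: (u *m B)); rewrite qform_perturb //.
have := kB (u *m B); move: (qform B (u *m B)) (sqnorm _) (qform B u) => x y z xy.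
rewrite -(pmulr_rge0 _ k0) => h.
have e : k * (z - k^-1 * y *+ 2 + k^-1 ^+ 2 * x) = k * z - y *+ 2 + k^-1 * x.
  by field; rewrite gt_eqF.
have : k^-1 * x <= y by rewrite mulrC ler_pdivrMr // mulrC.
rewrite e in h; lra.
Qed.

(** * Extreme eigenvalues of symmetric matrices *)

(** The best lower Rayleigh bound is an eigenvalue: otherwise [A - a] would be
    invertible, hence coercive, and the bound could be improved. *)
Lemma rayleigh_min A : (0 < m)%N -> A^T = A ->
  exists2 a, eigenvalue A a & forall u, a * sqnorm u <= qform A u.
Proof.
move=> m0 Asym.
pose S : set R := [set a | forall u, a * sqnorm u <= qform A u]%classic.
have [d d0 dA] := qform_bound (- A).
have Sne : (S !=set0)%classic.
  exists (- d) => u; have := dA u; rewrite qformN; lra.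
have Sub u a : u != 0 -> S a -> a <= qform A u / sqnorm u.
  by move=> u0 Sa; rewrite ler_pdivlMr ?sqnorm_gt0.
have one0 : const_mx 1 != 0 :> 'rV[R]_m.
  by apply/eqP => /rowP/(_ (Ordinal m0)); rewrite !mxE => /eqP; rewrite oner_eq0.
have Sbnd : has_ubound S by eexists => a Sa; exact: (Sub _ _ one0 Sa).
have Ssup : S (sup S).
  move=> u; have [->|u0] := eqVneq u 0.
    by rewrite /sqnorm /qform !mul0mx mxE mulr0.
  by rewrite -ler_pdivlMr ?sqnorm_gt0 //; apply: ge_sup => // a; exact: Sub.
exists (sup S) => //; set a := sup S in Ssup *.
rewrite /eigenvalue /eigenspace kermx_eq0 row_free_unit; apply/negP => Bunit.
have [||e e0 eB] := psd_unit_coercive _ _ Bunit.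
- by rewrite linearB /= tr_scalar_mx Asym.
- by move=> u; rewrite qformB qform_scalar subr_ge0.
have : S (a + e).
  by move=> u; have := eB u; rewrite qformB qform_scalar mulrDl; lra.
by move=> /(ub_le_sup Sbnd); rewrite gerDl leNgt e0.
Qed.

(** Reduces largest eigenvalues to smallest ones. *)
Lemma eigenvalueN A a : eigenvalue (- A) a = eigenvalue A (- a).
Proof.
apply/eigenvalueP/eigenvalueP => -[u uA u0]; exists u => //.
  by rewrite scaleNr -uA mulmxN opprK.
by rewrite mulmxN uA scaleNr opprK.
Qed.

Lemma lambda_minP A : (0 < m)%N -> A^T = A ->
  eigenvalue A (lambda_min A) /\
  forall u, lambda_min A * sqnorm u <= qform A u.
Proof.
move=> m0 Asym; have [a aA aP] := rayleigh_min A m0 Asym.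
suff -> : lambda_min A = a by [].
apply: set_minE => // b /eigenvalueP[u uA u0].
by rewrite -(ler_pM2r (sqnorm_gt0 _ u0)) -(qform_eigenvector _ _ _ uA).
Qed.

Lemma lambda_maxP A : (0 < m)%N -> A^T = A ->
  eigenvalue A (lambda_max A) /\
  forall u, qform A u <= lambda_max A * sqnorm u.
Proof.
move=> m0 Asym; have [|a aA aP] := rayleigh_min (- A) m0.
  by rewrite linearN /= Asym.
have le_qform u : qform A u <= - a * sqnorm u.
  by have := aP u; rewrite qformN; lra.
suff -> : lambda_max A = - a by rewrite -eigenvalueN.
apply: set_maxE => [|b /eigenvalueP[u uA u0]]; first by rewrite /spectrum /= -eigenvalueN.
by rewrite -(ler_pM2r (sqnorm_gt0 _ u0)) -(qform_eigenvector _ _ _ uA).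
Qed.

Lemma eigenvalue_lambda A a : (0 < m)%N -> A^T = A -> eigenvalue A a ->
  lambda_min A <= a <= lambda_max A.
Proof.
move=> m0 Asym /eigenvalueP[u uA u0].
have [_ mnP] := lambda_minP _ m0 Asym; have [_ mxP] := lambda_maxP _ m0 Asym.
have uE := qform_eigenvector _ _ _ uA; have upos := sqnorm_gt0 _ u0.
by have := mnP u; have := mxP u; rewrite uE !(ler_pM2r upos) => -> ->.
Qed.

(** * Extreme singular values *)

Lemma tr_gram A : (A^T *m A)^T = A^T *m A.
Proof. by rewrite trmx_mul trmxK. Qed.

Lemma eigenvalue_gram_ge0 A a : eigenvalue (A^T *m A) a -> 0 <= a.
Proof.
move=> /eigenvalueP[u /qform_eigenvector uA u0].
rewrite -(pmulr_lge0 _ (sqnorm_gt0 _ u0)) -uA -[X in _ *m X]trmxK.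
by rewrite -sqnorm_mulmx sqnorm_ge0.
Qed.

Lemma sqr_sigma_min A : (0 < m)%N -> sigma_min A ^+ 2 = lambda_min (A^T *m A).
Proof.
move=> m0; have [ev _] := lambda_minP _ m0 (tr_gram A).
suff -> : sigma_min A = Num.sqrt (lambda_min (A^T *m A)).
  by rewrite sqr_sqrtr // (eigenvalue_gram_ge0 _ _ ev).
apply: set_minE; first by exists (lambda_min (A^T *m A)).
move=> _ [a aA <-]; apply: ler_wsqrtr.
by have /andP[] := eigenvalue_lambda _ _ m0 (tr_gram A) aA.
Qed.

Lemma sqr_sigma_max A : (0 < m)%N -> sigma_max A ^+ 2 = lambda_max (A^T *m A).
Proof.
move=> m0; have [ev _] := lambda_maxP _ m0 (tr_gram A).
suff -> : sigma_max A = Num.sqrt (lambda_max (A^T *m A)).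
  by rewrite sqr_sqrtr // (eigenvalue_gram_ge0 _ _ ev).
apply: set_maxE; first by exists (lambda_max (A^T *m A)).
move=> _ [a aA <-]; apply: ler_wsqrtr.
by have /andP[] := eigenvalue_lambda _ _ m0 (tr_gram A) aA.
Qed.

(** * Positive definite matrices and their inverses *)

Lemma posdef_qform_gt0 A u : sym_posdef A -> u != 0 -> 0 < qform A u.
Proof.
move=> [_ /(_ u^T)]; rewrite trmxK => h u0; apply: h.
by rewrite trmx_eq0.
Qed.

Lemma posdef_eigenvalue_gt0 A a : sym_posdef A -> eigenvalue A a -> 0 < a.
Proof.
move=> Apd /eigenvalueP[u uA u0].
rewrite -(pmulr_lgt0 _ (sqnorm_gt0 _ u0)) -(qform_eigenvector _ _ _ uA).
exact: posdef_qform_gt0.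
Qed.

Lemma posdef_unit A : sym_posdef A -> A \in unitmx.
Proof.
move=> Apd; rewrite -row_free_unit -kermx_eq0.
have : ~~ eigenvalue A 0.
  by apply/negP => /(posdef_eigenvalue_gt0 _ _ Apd); rewrite ltxx.
by rewrite /eigenvalue /eigenspace raddf0 subr0 negbK.
Qed.

Lemma eigenvalue_invmx A a : A \in unitmx -> eigenvalue (invmx A) a ->
  eigenvalue A a^-1.
Proof.
move=> Aunit /eigenvalueP[u uA u0]; apply/eigenvalueP; exists u => //.
have uE : u = a *: (u *m A) by rewrite scalemxAl -uA mulmxKV.
have a0 : a != 0 by apply: contraNneq u0 => a0; rewrite uE a0 scale0r.
by rewrite [in RHS]uE scalerA mulVf // scale1r.
Qed.

(** Inversion maps eigenvalues of [invmx A] to eigenvalues of [A] and reverses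
    the order on them, as they are positive. *)
Lemma lambda_invmx_bounds A : (0 < m)%N -> sym_posdef A ->
  (lambda_max A)^-1 <= lambda_min (invmx A) /\
  lambda_max (invmx A) <= (lambda_min A)^-1.
Proof.
move=> m0 Apd; have [Asym _] := Apd; have Aunit := posdef_unit _ Apd.
have iAsym : (invmx A)^T = invmx A by rewrite trmx_inv Asym.
have inv_bounds a : eigenvalue (invmx A) a ->
    (lambda_max A)^-1 <= a /\ a <= (lambda_min A)^-1.
  move=> /(eigenvalue_invmx _ _ Aunit) aA.
  have a0 := posdef_eigenvalue_gt0 _ _ Apd aA.
  have mn0 := posdef_eigenvalue_gt0 _ _ Apd (lambda_minP _ m0 Asym).1.
  have /andP[mn mx] := eigenvalue_lambda _ _ m0 Asym aA.
  have mx0 := lt_le_trans a0 mx.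
  by rewrite -(invrK a); split; rewrite lef_pV2 ?posrE.
split; first by have [] := inv_bounds _ (lambda_minP _ m0 iAsym).1.
by have [] := inv_bounds _ (lambda_maxP _ m0 iAsym).1.
Qed.

Lemma qform_invmx A w : (0 < m)%N -> sym_posdef A ->
  sqnorm w / lambda_max A <= qform (invmx A) w <= sqnorm w / lambda_min A.
Proof.
move=> m0 Apd; have [Asym _] := Apd.
have iAsym : (invmx A)^T = invmx A by rewrite trmx_inv Asym.
have [mn mx] := lambda_invmx_bounds _ m0 Apd.
rewrite ![sqnorm w / _]mulrC; apply/andP; split.
- apply: le_trans (ler_wpM2r (sqnorm_ge0 w) mn) _.
  exact: (lambda_minP _ m0 iAsym).2.
- apply: le_trans (ler_wpM2r (sqnorm_ge0 w) mx).
  exact: (lambda_maxP _ m0 iAsym).2.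
Qed.

(** * The bounds *)

(** Evaluate the form of [E] at an extreme eigenvector [u]: it is the form of
    [invmx q] at [u *m g^T], whose squared norm is the form of [g^T *m g] at
    [u]. *)
Lemma lambda_congr_bounds (q g : 'M[R]_m) : (0 < m)%N -> sym_posdef q ->
  let E := g^T *m invmx q *m g in
  [/\ sigma_min g ^+ 2 / lambda_max q <= lambda_min E,
      lambda_min E <= lambda_max E &
      lambda_max E <= sigma_max g ^+ 2 / lambda_min q].
Proof.
move=> m0 qpd E; have [qsym _] := qpd.
have Esym : E^T = E by rewrite /E !trmx_mul trmxK trmx_inv qsym mulmxA.
have EE u : qform E u = qform (invmx q) (u *m g^T).
  by rewrite -qform_congr trmxK.
have gE u : sqnorm (u *m g^T) = qform (g^T *m g) u.
  by rewrite sqnorm_mulmx trmxK.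
have [Emn _] := lambda_minP _ m0 Esym; have [Emx _] := lambda_maxP _ m0 Esym.
have [qmn _] := lambda_minP _ m0 qsym; have [qmx _] := lambda_maxP _ m0 qsym.
have mn0 := posdef_eigenvalue_gt0 _ _ qpd qmn.
have mx0 := posdef_eigenvalue_gt0 _ _ qpd qmx.
split.
- have /eigenvalueP[u /qform_eigenvector uE u0] := Emn.
  rewrite -(ler_pM2r (sqnorm_gt0 _ u0)) -uE EE sqr_sigma_min // mulrAC.
  have /andP[+ _] := qform_invmx _ (u *m g^T) m0 qpd; apply: le_trans.
  by rewrite ler_pM2r ?invr_gt0 // gE (lambda_minP _ m0 (tr_gram g)).2.
- by have /andP[] := eigenvalue_lambda _ _ m0 Esym Emn.
- have /eigenvalueP[u /qform_eigenvector uE u0] := Emx.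
  rewrite -(ler_pM2r (sqnorm_gt0 _ u0)) -uE EE sqr_sigma_max // mulrAC.
  have /andP[_ ] := qform_invmx _ (u *m g^T) m0 qpd; move=> /le_trans; apply.
  by rewrite ler_pM2r ?invr_gt0 // gE (lambda_maxP _ m0 (tr_gram g)).2.
Qed.

End QuadraticForms.

(** The form of a block diagonal matrix is the sum of the forms of its blocks
    at the corresponding pieces of the vector, at least one of which is
    nonzero. *)
Lemma sym_posdef_mxdiag (R : realType) (N : nat) (p_ : 'I_N -> nat)
    (qs : forall k, 'M[R]_(p_ k)) :
  (forall k, sym_posdef (qs k)) -> sym_posdef (\mxdiag_k qs k).
Proof.
move=> qpd; split=> [|x x0].
  by rewrite tr_mxdiag; apply: eq_mxdiag => k; case: (qpd k).
have qE : (x^T *m \mxdiag_k qs k *m x) 0 0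
          = \sum_k qform (qs k) (submxcol x k)^T.
  rewrite -{1 2}[x]submxcolK tr_mxcol mul_mxrow_mxdiag mul_mxrow_mxcol summxE.
  by apply: eq_bigr => k _; rewrite /qform trmxK.
have block_ge0 k : 0 <= qform (qs k) (submxcol x k)^T.
  have [->|xk0] := eqVneq (submxcol x k)^T 0.
    by rewrite /qform !mul0mx mxE.
  by rewrite ltW // posdef_qform_gt0.
have [k xk0] : exists k, submxcol x k != 0.
  apply/existsP; apply: contraNT x0; rewrite negb_exists => /forallP x0.
  rewrite -[x]submxcolK -mxcol0; apply/eqP/eq_mxcol => k.
  by apply/eqP; have := x0 k; rewrite negbK.
rewrite qE (bigD1 k) //= ltr_pwDl ?sumr_ge0 //.
by rewrite posdef_qform_gt0 ?trmx_eq0.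
Qed.

Theorem mainTheorem1 (R : realType) (n N : nat) (n_ge1 : (1 <= n)%N)
    (N_ge1 : (1 <= N)%N) (qs gs : 'I_N -> 'M[R]_n)
    (qs_posdef : forall k : 'I_N, sym_posdef (qs k)) :
  let q : 'M[R]_(\sum_(i < N) n) := \mxdiag_(i < N) qs i in
  let g : 'M[R]_(\sum_(i < N) n) := block_bidiag gs in
  let E : 'M[R]_(\sum_(i < N) n) := g^T *m invmx q *m g in
  [/\ sigma_min g ^+ 2 / lambda_max q <= lambda_min E,
      lambda_min E <= lambda_max E &
      lambda_max E <= sigma_max g ^+ 2 / lambda_min q].
Proof.
move=> q g E; apply: lambda_congr_bounds; last exact: sym_posdef_mxdiag.
by rewrite sum_nat_const card_ord muln_gt0 n_ge1 N_ge1.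
Qed.
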